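(* Assume the setting, notation and standing assumptions of the context. Let $s\in\mathbf{s}$ be such that $\hat{x}:=\hat{x}(s)\in\operatorname{int}(\mathbf{x})$, and let $0<u\in\mathbb{R}^n$ be such that $$\overline{\mathfrak{b}}(s)+\bigl(\mathfrak{B}_0(s)+\mathfrak{B}(s)\,u\bigr)u\le u,\qquad M_u(s):=\{x\mid |x-\hat{x}|\le u\}\subseteq\mathbf{x},$$ where $\mathfrak{B}(s)\in\mathbb{R}^{n\times n\times n}$ satisfies $\mathfrak{B}(s)\ge\mathfrak{B}(x,s)$ for all $x\in M_u(s)$. In addition, take $\mathfrak{B}(s)$ such that $$\mathfrak{B}(s)\ge\mathfrak{B}(x,s)\qquad\text{for all }x\in\mathbf{x}.$$ For $0<v\in\mathbb{R}^n$ define $$\mathfrak{w}(s):=(\mathbb{1}-\mathfrak{B}_0(s))v,\qquad \mathfrak{a}(s):=v^T\mathfrak{B}(s)v .$$ If $$D_j(s):=\mathfrak{w}_j(s)^2-4\,\mathfrak{a}_j(s)\,\overline{\mathfrak{b}}_j(s)>0\qquad\text{for all } j=1,\dots,n,$$ define $$\lambda_j^e(s):=\frac{\mathfrak{w}_j(s)+\sqrt{D_j(s)}}{2\mathfrak{a}_j(s)},\quad \lambda_j^i(s):=\frac{\overline{\mathfrak{b}}_j(s)}{\mathfrak{a}_j(s)\,\lambda_j^e(s)},\quad \lambda_s^e:=\min_j\lambda_j^e(s),\quad \lambda_s^i:=\max_j\lambda_j^i(s).$$ If $\lambda_s^e>\lambda_s^i$ and $\hat{x}_j+[-1,1]\,\lambda_s^i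 v_j\subseteq\mathbf{x}_j$ for all $j$, then there exists at least one zero $x^*$ of $H(\cdot,s)$, i.e. $H(x^*,s)=0$, in the inclusion region $$\mathbf{R}^i_s:=[\hat{x}-\lambda_s^iv,\ \hat{x}+\lambda_s^iv]\subseteq\mathbf{x},$$ and these zeros are the only zeros of $H(\cdot,s)$ in the interior of the exclusion region $$\mathbf{R}^e_s:=[\hat{x}-\lambda_s^ev,\ \hat{x}+\lambda_s^ev]\cap\mathbf{x}.$$
   Context: Conventions. Inequalities and absolute values of vectors, matrices and 3-tensors are componentwise; a box is a product of compact intervals, with $\mathbf{x}_j$ the $j$th component interval of $\mathbf{x}$; $\mathbb{1}$ is the identity matrix. For a 3-tensor $\mathcal{T}$, vector $u$ and matrices $M,N$ of fitting sizes: $(\mathcal{T}u)_{ij}=\sum_k\mathcal{T}_{ijk}u_k$, $(M\mathcal{T})_{ijk}=\sum_l M_{il}\mathcal{T}_{ljk}$, $(\mathcal{T}N)_{ijk}=\sum_l\mathcal{T}_{ijl}N_{lk}$, and $u^T\mathcal{T}u:=(\mathcal{T}u)u$. Setting. $H:X\times S\to\mathbb{R}^n$, $X\subseteq\mathbb{R}^n$, $S\subseteq\mathbb{R}^q$, is differentiable with Lipschitz continuous derivative; $H'_x$ is its Jacobian with respect to $x$. $\mathbf{x}\subseteq X$ and $\mathbf{s}\subseteq S$ are boxes, and $(z,p)\in\mathbf{x}\times\mathbf{s}$ is an approximate solution, $H(z,p)\approx0$ (the letter $p$ denotes a parameter value in $\mathbb{R}^q$). The Jacobian $H'_x(z,p)$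 is assumed regular, and $C\in\mathbb{R}^{n\times n}$ is a fixed preconditioning matrix, $C\approx H'_x(z,p)^{-1}$. Slopes. A slope of a function $F$ with center $a$ at $b$ is a matrix (tensor, if $F$ is matrix-valued) $F[a,b]$ with $F(b)-F(a)=F[a,b](b-a)$. Fixed choices of the following slopes are given: first order slopes $H[\cdot,\cdot]\in\mathbb{R}^{n\times(n+q)}$ of $H$, whose first $n$ columns are denoted $H_x[\cdot,\cdot]$; slopes $(H'_x)[\cdot,\cdot]\in\mathbb{R}^{n\times n\times(n+q)}$ of $H'_x$; and second order slopes $H_{xx}\in\mathbb{R}^{n\times n\times n}$ with respect to $x$, satisfying $H_x[(a,s),(x,s)]=H'_x(a,s)+H_{xx}[(a,s),(a,s),(x,s)](x-a)$. Base bounds. $\overline{b}\ge|CH(z,p)|$, $B_0\ge|CH'_x(z,p)-\mathbb{1}|$, and $\overline{B}\ge|C\,H_{xx}[(z,p),(z,p),(x,p)]|$ for all $x\in\mathbf{x}$. It is assumed that a pair of inclusion/exclusion regions can be computed at $(z,p)$: for some vector $0<v^0\in\mathbb{R}^n$, with $w=(\mathbb{1}-B_0)v^0$, $a=(v^0)^T\overline{B}v^0$, one has $D_j=w_j^2-4a_j\overline{b}_j>0$ for all $j$, and with $\lambda_j^e=\frac{w_j+\sqrt{D_j}}{2a_j}$, $\lambda_j^i=\frac{\overline{b}_j}{a_j\lambda_j^e}$, $\lambda^e=\min_j\lambda_j^e$, $\lambda^i=\max_j\lambda_j^i$ one has $\lambda^e>\lambda^i$ and $[z-\lambda^iv^0,z+\lambda^iv^0]\subseteq\mathbf{x}$.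 Approximation function. $\hat{x}:\mathbb{R}^q\to\mathbb{R}^n$ is continuously differentiable with $\hat{x}(p)=z$ and $\hat{x}(s)\in\mathbf{x}$ for all $s\in\mathbf{s}$; $\hat{x}[p,s]$ is a slope matrix of it. Put $g(s)=\begin{pmatrix}\hat{x}(s)\\ s\end{pmatrix}$ with slope $g[p,s]=\begin{pmatrix}\hat{x}[p,s]\\ \mathbb{1}\end{pmatrix}\in\mathbb{R}^{(n+q)\times q}$. Parameter-dependent bounds. For $s\in\mathbf{s}$ let $\overline{\mathfrak{b}}(s)=\overline{b}+G_0(s)|s-p|$ with $G_0(s)=|C\,H[g(p),g(s)]|\,|g[p,s]|$; $\mathfrak{B}_0(s)=B_0+A(s)|s-p|$ with $A(s)=|C\,(H'_x)[g(p),g(s)]|\,|g[p,s]|\in\mathbb{R}^{n\times n\times q}$; and let $\mathfrak{B}(x,s)\in\mathbb{R}^{n\times n\times n}$ satisfy $\mathfrak{B}(x,s)\ge|C\,H_{xx}[g(s),g(s),(x,s)]|$. *)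

(* Defs.v *)
From mathcomp Require Export all_boot all_order all_algebra.
From mathcomp Require Export all_classical all_reals all_analysis.
Export Order.TTheory GRing.Theory Num.Theory.
Export numFieldNormedType.Exports.

Set Implicit Arguments.
Unset Strict Implicit.
Unset Printing Implicit Defensive.

Local Open Scope classical_set_scope.
Local Open Scope ring_scope.

(* Vectors are column vectors, and a pair (x, s) in R^n x R^q is the stacked
   vector [col_mx x s].  On matrices, the library's [`|A|] is the max norm;
   [mxabs] is the componentwise absolute value. *)

Definition mxabs (R : realType) (m n : nat) (A : 'M[R]_(m, n)) : 'M[R]_(m, n) :=
  map_mx (fun r : R => `|r|) A.

Definition mxle (R : realType) (m n : nat) (A B : 'M[R]_(m, n)) : Prop :=
  forall i j, A i j <= B i j.

Definition mxpos (R : realType) (n : nat) (v : 'cV[R]_n) : Prop :=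
  forall j, 0 < v j 0.

Definition tensor (R : realType) (m n k : nat) : Type :=
  'I_m -> 'I_n -> 'I_k -> R.

Definition tabs (R : realType) (m n k : nat) (T : tensor R m n k) :
    tensor R m n k :=
  fun i j l => `|T i j l|.

Definition tle (R : realType) (m n k : nat) (T U : tensor R m n k) : Prop :=
  forall i j l, T i j l <= U i j l.

Definition tmulv (R : realType) (m n k : nat) (T : tensor R m n k)
    (u : 'cV[R]_k) : 'M[R]_(m, n) :=
  \matrix_(i, j) \sum_l T i j l * u l 0.

Definition mmult (R : realType) (m' m n k : nat) (M : 'M[R]_(m', m))
    (T : tensor R m n k) : tensor R m' n k :=
  fun i j l => \sum_h M i h * T h j l.

Definition tmulm (R : realType) (m n k k' : nat) (T : tensor R m n k)
    (N : 'M[R]_(k, k')) : tensor R m n k' :=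
  fun i j l => \sum_h T i j h * N h l.

(* u^T T u, defined as (T u) u *)
Definition tquad (R : realType) (m n : nat) (T : tensor R m n n)
    (u : 'cV[R]_n) : 'cV[R]_m :=
  tmulv T u *m u.

Definition box (R : realType) (n : nat) (l u : 'cV[R]_n) : set 'cV[R]_n :=
  [set x | forall j, l j 0 <= x j 0 <= u j 0].

Definition pairs (R : realType) (n q : nat) (X : set 'cV[R]_n)
    (S : set 'cV[R]_q) : set 'cV[R]_(n + q) :=
  [set y | X (usubmx y) /\ S (dsubmx y)].

(* [J] is a derivative of [f : D -> R^m] at [y]:
     f(y') = f(y) + J (y' - y) + o(y' - y)   as y' -> y in D.
   The values of [f] outside [D] are irrelevant; when [y] is an interior point
   of [D], this is Frechet differentiability with Jacobian matrix [J]. *)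
Definition has_jacobian (R : realType) (k m : nat) (D : set 'cV[R]_k)
    (f : 'cV[R]_k -> 'cV[R]_m) (y : 'cV[R]_k) (J : 'M[R]_(m, k)) : Prop :=
  forall e : R, 0 < e -> \forall y' \near within D (nbhs y),
    `|f y' - f y - J *m (y' - y)| <= e * `|y' - y|.

(* The library's [jacobian] is for row vectors. *)
Definition cjacobian (R : realType) (k m : nat) (f : 'cV[R]_k -> 'cV[R]_m)
    (y : 'cV[R]_k) : 'M[R]_(m, k) :=
  \matrix_(i, j) ('d f y (delta_mx j 0) : 'cV[R]_m) i 0.

Definition continuously_differentiable (R : realType) (k m : nat)
    (f : 'cV[R]_k -> 'cV[R]_m) : Prop :=
  (forall y, differentiable f y) /\ continuous (cjacobian f).

Definition is_slope (R : realType) (k m : nat) (f : 'cV[R]_k -> 'cV[R]_m)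
    (a b : 'cV[R]_k) (M : 'M[R]_(m, k)) : Prop :=
  f b - f a = M *m (b - a).

Definition is_tslope (R : realType) (k m n : nat)
    (F : 'cV[R]_k -> 'M[R]_(m, n)) (a b : 'cV[R]_k) (T : tensor R m n k) : Prop :=
  F b - F a = tmulv T (b - a).

Definition vmin (R : realType) (n : nat) (f : 'I_n.+1 -> R) : R :=
  \big[Num.min/f ord0]_j f j.

Definition vmax (R : realType) (n : nat) (f : 'I_n.+1 -> R) : R :=
  \big[Num.max/f ord0]_j f j.

Definition reg_w (R : realType) (n : nat) (B0 : 'M[R]_n) (v : 'cV[R]_n) :
    'cV[R]_n :=
  (1%:M - B0) *m v.

Definition reg_a (R : realType) (n : nat) (B : tensor R n n n) (v : 'cV[R]_n) :
    'cV[R]_n :=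
  tquad B v.

Definition reg_D (R : realType) (n : nat) (b : 'cV[R]_n) (B0 : 'M[R]_n)
    (B : tensor R n n n) (v : 'cV[R]_n) (j : 'I_n) : R :=
  reg_w B0 v j 0 ^+ 2 - 4 * reg_a B v j 0 * b j 0.

(* Division by zero yields 0 here, so a_j = 0 gives lambda^e_j = lambda^i_j = 0.
   Hence lambda^i < lambda^e, where lambda^i = max_j lambda^i_j and
   lambda^e = min_j lambda^e_j, forces a_j <> 0 for all j, so the quotients
   by a_j are genuine whenever that inequality is assumed. *)
Definition lame_j (R : realType) (n : nat) (b : 'cV[R]_n) (B0 : 'M[R]_n)
    (B : tensor R n n n) (v : 'cV[R]_n) (j : 'I_n) : R :=
  (reg_w B0 v j 0 + Num.sqrt (reg_D b B0 B v j)) / (2 * reg_a B v j 0).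

Definition lami_j (R : realType) (n : nat) (b : 'cV[R]_n) (B0 : 'M[R]_n)
    (B : tensor R n n n) (v : 'cV[R]_n) (j : 'I_n) : R :=
  b j 0 / (reg_a B v j 0 * lame_j b B0 B v j).

Definition lame (R : realType) (n : nat) (b : 'cV[R]_n.+1) (B0 : 'M[R]_n.+1)
    (B : tensor R n.+1 n.+1 n.+1) (v : 'cV[R]_n.+1) : R :=
  vmin (lame_j b B0 B v).

Definition lami (R : realType) (n : nat) (b : 'cV[R]_n.+1) (B0 : 'M[R]_n.+1)
    (B : tensor R n.+1 n.+1 n.+1) (v : 'cV[R]_n.+1) : R :=
  vmax (lami_j b B0 B v).

Definition graph_pt (R : realType) (n q : nat) (xhat : 'cV[R]_q -> 'cV[R]_n)
    (s : 'cV[R]_q) : 'cV[R]_(n + q) :=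
  col_mx (xhat s) s.

Definition graph_slope (R : realType) (n q : nat)
    (xsl : 'cV[R]_q -> 'cV[R]_q -> 'M[R]_(n, q)) (p s : 'cV[R]_q) :
    'M[R]_(n + q, q) :=
  col_mx (xsl p s) 1%:M.

Definition par_b (R : realType) (n q : nat) (C : 'M[R]_n)
    (Hsl : 'cV[R]_(n + q) -> 'cV[R]_(n + q) -> 'M[R]_(n, n + q))
    (xhat : 'cV[R]_q -> 'cV[R]_n) (xsl : 'cV[R]_q -> 'cV[R]_q -> 'M[R]_(n, q))
    (b : 'cV[R]_n) (p s : 'cV[R]_q) : 'cV[R]_n :=
  let G0 := mxabs (C *m Hsl (graph_pt xhat p) (graph_pt xhat s))
              *m mxabs (graph_slope xsl p s) in
  b + G0 *m mxabs (s - p).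

Definition par_B0 (R : realType) (n q : nat) (C : 'M[R]_n)
    (dHxsl : 'cV[R]_(n + q) -> 'cV[R]_(n + q) -> tensor R n n (n + q))
    (xhat : 'cV[R]_q -> 'cV[R]_n) (xsl : 'cV[R]_q -> 'cV[R]_q -> 'M[R]_(n, q))
    (B0 : 'M[R]_n) (p s : 'cV[R]_q) : 'M[R]_n :=
  let A := tmulm (tabs (mmult C (dHxsl (graph_pt xhat p) (graph_pt xhat s))))
             (mxabs (graph_slope xsl p s)) in
  B0 + tmulv A (mxabs (s - p)).

(* Main.v *)
Require Import Defs.
From mathcomp Require Import perm fingroup ring lra zify.

Set Implicit Arguments.
Unset Strict Implicit.
Unset Printing Implicit Defensive.

Local Open Scope classical_set_scope.
Local Open Scope ring_scope.

(** Write c for xhat(s). The second order slope expansion of H(., s) at c gives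
    |(x - c) - C H(x, s)| <= b + (B0 + B |x - c|) |x - c| on the box, and if
    |x - c| <= t v the j-th component of the right-hand side is at most
    t v_j + a_j (t - lambda^i_j) (t - lambda^e_j). For t = lambda^i the
    quadratic term is <= 0, so C H(., s) has opposite signs on opposite faces of
    R^i, and the Poincare-Miranda theorem provides a zero. If x is a zero in
    the interior of R^e and t is the least number with |x - c| <= t v, then
    t < lambda^e, and the inequality at a component where |x - c|_j = t v_j
    forces t <= lambda^i.
    The sign w_j > 0, needed to exclude negative lambdas, comes from u: if some
    w_j <= 0 then lambda^i < lambda^e forces B0 v > v in every component, which
    contradicts B0 u <= u with u > 0. Moreover w > 0 means B0 v < v, so that
    C H'_x(c, s), and hence C, is regular.
    Poincare-Miranda is reduced by compactness to 0/1-labellings f_1, ..., f_n of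
    a grid, where some Kuhn simplex must see both values of every label: the sum
    over all Kuhn simplices of the mod 2 cup product df_1 u ... u df_n does not
    change, by Stokes' theorem, when a label is replaced by another one with the
    same boundary values, and it is 1 for f_k(y) = [y_k > 0]. *)

(** * The Poincare-Miranda theorem on a grid *)

Section KuhnSums.
Variable F2 : idomainType.
Hypothesis addrr_F2 : forall x : F2, x + x = 0.

Lemma oppr_F2 (x : F2) : - x = x.
Proof. by apply/eqP; rewrite eq_sym -subr_eq0 opprK addrr_F2. Qed.

(** The mod 2 simplicial coboundary: a face drops the first vertex, or keeps it and drops a later
    one. *)
Fixpoint cobd (V : Type) (c : seq V -> F2) (s : seq V) : F2 :=
  if s is a :: s' then c s' + cobd (fun t => c (a :: t)) s' else 0.

Definition cup0 (V : Type) (h : V -> F2) (c : seq V -> F2) (s : seq V) :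
    F2 :=
  if s is a :: _ then h a * c s else 0.

(* The cup product of the 1-cochain [df] with [c]; likewise [cup0 h c] is the
   cup product of the 0-cochain [h] with [c]. *)
Definition cup1 (V : Type) (f : V -> F2) (c : seq V -> F2) (s : seq V) :
    F2 :=
  if s is a :: ((b :: _) as s') then (f a + f b) * c s' else 0.

Definition cunit (V : Type) (s : seq V) : F2 := (size s == 1)%:R.

Definition cups (V K : Type) (F : K -> V -> F2) (ks : seq K)
    (c : seq V -> F2) : seq V -> F2 :=
  foldr (fun k => cup1 (F k)) c ks.

Section Cochains.
Variable V : Type.
Implicit Types (c : seq V -> F2) (s t : seq V) (f h : V -> F2).

Lemma eq_cobd c c' : c =1 c' -> cobd c =1 cobd c'.
Proof.
move=> cc' s; elim: s c c' cc' => //= a s IHs c c' cc'.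
by rewrite cc'; congr (_ + _); apply: IHs => t; rewrite cc'.
Qed.

Lemma cobdZ x c s : cobd (fun t => x * c t) s = x * cobd c s.
Proof.
elim: s c => [|a s IHs] c /=; first by rewrite mulr0.
by rewrite mulrDr -IHs.
Qed.

Lemma cobdE c s :
  cobd c s = \sum_(i < size s) c (take i s ++ drop i.+1 s).
Proof.
elim: s c => [|a s IHs] c /=; first by rewrite big_ord0.
by rewrite big_ord_recl /= drop0 IHs.
Qed.

(** The Leibniz rule d(h u c) = dh u c + h u dc; [c [::] = 0] enters because the coboundary of a
    one-vertex sequence evaluates [c] at [[::]]. *)
Lemma cobd_cup0 h c s :
  c [::] = 0 -> cobd (cup0 h c) s = cup1 h c s + cup0 h (cobd c) s.
Proof.
move=> c0; case: s => [|a s] /=; first by rewrite addr0.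
rewrite (cobdZ _ (fun t => c (a :: t))).
case: s => [|b r] /=; first by rewrite c0 !(addr0, mulr0).
by rewrite -[LHS]addr0 -(addrr_F2 (h a * c (b :: r))); ring.
Qed.

(** The Leibniz rule for the factor [df], together with d(df) = 0. *)
Lemma cobd_cup1 f c s :
  c [::] = 0 -> cobd (cup1 f c) s = cup1 f (cobd c) s.
Proof.
move=> c0; case: s => [//|a [|b r]] /=; first by rewrite addr0.
rewrite (cobdZ _ (fun t => c (b :: t))) mulrDr addrA; congr (_ + _).
case: r => [|e r] /=; first by rewrite c0 addr0 mulr0.
rewrite -mulrDl; congr (_ * _).
by rewrite -[RHS]addr0 -(addrr_F2 (f e)); ring.
Qed.

Lemma cobd_cunit s : cobd (@cunit V) s = 0.
Proof.
case: s => [|a [|b r]] //=; rewrite /cunit /= ?add0r ?addr0 //.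
rewrite (eq_cobd (c' := fun=> 0 * 0)) => [|t]; last by rewrite mul0r.
by rewrite (cobdZ 0 (fun=> 0)) mul0r addr0 addrr_F2.
Qed.

End Cochains.

Section Cups.
Variables (V K : Type).
Implicit Types (c : seq V -> F2) (s : seq V) (F : K -> V -> F2).
Implicit Types (f h : V -> F2) (ks : seq K).

Lemma cups_nil F ks c : c [::] = 0 -> cups F ks c [::] = 0.
Proof. by case: ks. Qed.

Lemma eq_cup1 f c c' : c =1 c' -> cup1 f c =1 cup1 f c'.
Proof. by move=> cc' [|a [|b s]] //=; rewrite cc'. Qed.

Lemma eq_cups F ks c c' : c =1 c' -> cups F ks c =1 cups F ks c'.
Proof. by move=> cc'; elim: ks => //= k ks IHks; apply: eq_cup1. Qed.

Lemma cobd_cups F ks c :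
  c [::] = 0 -> cobd (cups F ks c) =1 cups F ks (cobd c).
Proof.
move=> c0; elim: ks => //= k ks IHks s.
by rewrite cobd_cup1 ?cups_nil //; apply: eq_cup1.
Qed.

Lemma cups0 F ks s : cups F ks (fun=> 0) s = 0.
Proof.
elim: ks s => //= k ks IHks [|a [|b s]] //=.
by rewrite IHks mulr0.
Qed.

Lemma cup1D f c c' s :
  cup1 f (fun t => c t + c' t) s = cup1 f c s + cup1 f c' s.
Proof. by case: s => [|a [|b s]] //=; rewrite ?addr0 // mulrDr. Qed.

Lemma cupsD F ks c c' s :
  cups F ks (fun t => c t + c' t) s = cups F ks c s + cups F ks c' s.
Proof.
elim: ks s => //= k ks IHks s.
by rewrite -cup1D; apply: eq_cup1.
Qed.

(** Cochains relative to the subcomplex spanned by [P]; in use, [P] is a facet of the grid. *)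
Definition vanish (P : pred V) c := forall s, all P s -> c s = 0.

Lemma vanish_cup0 (P : pred V) h c : vanish P c -> vanish P (cup0 h c).
Proof. by move=> vc [//|a s] Ps /=; rewrite vc ?mulr0. Qed.

Lemma vanish_cup1 (P : pred V) f c : vanish P c -> vanish P (cup1 f c).
Proof. by move=> vc [|a [|b s]] //= /and3P[_ Pb Ps]; rewrite vc ?mulr0 //= Pb. Qed.

Lemma vanish_cups (P : pred V) F ks c : vanish P c -> vanish P (cups F ks c).
Proof. by move=> vc; elim: ks => //= k ks IHks; apply: vanish_cup1. Qed.

Lemma vanish_cup0_eq0 (P : pred V) h c :
  (forall y, P y -> h y = 0) -> vanish P (cup0 h c).
Proof. by move=> h0 [//|a s] /= /andP[/h0 -> _]; rewrite mul0r. Qed.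

Lemma vanish_cup1_const (P : pred V) f c x :
  (forall y, P y -> f y = x) -> vanish P (cup1 f c).
Proof.
move=> fx [|a [|b s]] //= /and3P[/fx -> /fx -> _].
by rewrite addrr_F2 mul0r.
Qed.

End Cups.

Lemma vanish_cups_const (V : Type) (K : eqType) (P : pred V)
    (F : K -> V -> F2) (ks : seq K) (c : seq V -> F2) k x :
  k \in ks -> (forall y, P y -> F k y = x) -> vanish P (cups F ks c).
Proof.
move=> kks Fk; elim: ks kks => //= k' ks IHks.
rewrite inE => /predU1P[<-|/IHks]; first exact: vanish_cup1_const Fk.
exact: vanish_cup1.
Qed.

Lemma eq_in_cups (V : Type) (K : eqType) (F G : K -> V -> F2) (ks : seq K)
    (c : seq V -> F2) :
  {in ks, F =1 G} -> cups F ks c = cups G ks c.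
Proof.
elim: ks => //= k ks IHks FG; rewrite FG ?mem_head // IHks // => j jks.
by apply: FG; rewrite inE jks orbT.
Qed.

(** Each factor consumes one edge, and [cunit] is 1 on the single vertex left over. *)
Lemma cups_prod (V : Type) n (F : 'I_n -> V -> F2) (v : nat -> V) :
  cups F (enum 'I_n) (@cunit V) (mkseq v n.+1) =
  \prod_k (F k (v k) + F k (v k.+1)).
Proof.
rewrite -(big_enum _ _ predT) /= /mkseq.
have gen ks m : map val ks = iota m (size ks) ->
    cups F ks (@cunit V) (map v (iota m (size ks).+1)) =
    \prod_(k <- ks) (F k (v k) + F k (v k.+1)).
  elim: ks m => [|k ks IHks] m /=; first by rewrite big_nil.
  case=> <- /IHks IH; rewrite big_cons -IH /=.
  by case: ks {IH IHks} => //= k' ks.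
by rewrite -(gen _ 0%N) size_enum_ord ?val_enum_ord.
Qed.

(* The Kuhn simplex of the cube at [x] in which coordinate [j] is incremented
   at step [r j]: [r] maps coordinates to steps, not steps to coordinates. *)
Definition kuhn_vertex n (x : 'I_n -> nat) (r : 'S_n) (i : nat) : 'I_n -> nat :=
  fun j => (x j + (r j < i))%N.

Definition kuhn_simplex n (x : 'I_n -> nat) (r : 'S_n) : seq ('I_n -> nat) :=
  mkseq (kuhn_vertex x r) n.+1.

(* A cyclic rotation of coordinate [j]; the wrapped-around terms vanish. *)
Lemma sum_shift_coord n N (j : 'I_n) (f : ('I_n -> nat) -> F2) :
  (forall y, y j = 0%N -> f y = 0) -> (forall y, y j = N -> f y = 0) ->
  \sum_(x : {ffun 'I_n -> 'I_N}) f (fun i => (x i + (i == j))%N) =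
  \sum_(x : {ffun 'I_n -> 'I_N}) f (fun i => x i).
Proof.
move=> f0 fN.
pose h (g : 'I_N -> 'I_N) (x : {ffun 'I_n -> 'I_N}) :=
  [ffun i => if i == j then g (x i) else x i].
have hK : cancel (h (@ordS N)) (h (@ord_pred N)).
  by move=> x; apply/ffunP => i; rewrite !ffunE; case: eqP => // _; rewrite ordSK.
rewrite [RHS](reindex_inj (can_inj hK)) /=; apply: eq_bigr => x _.
have [xN|xN] := ltnP (x j).+1 N.
  congr f; apply/funext => i; rewrite ffunE; case: eqP => [->|_] /=.
    by rewrite modn_small // addn1.
  by rewrite addn0.
have xjN : (x j).+1 = N by apply/eqP; rewrite eqn_leq xN ltn_ord.
rewrite fN ?eqxx ?addn1 // f0 // ffunE eqxx /= xjN modnn //.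
Qed.

(** * Stokes' theorem on the Kuhn triangulation of the grid *)

Section Stokes.
Variables (n N : nat) (c : seq ('I_n.+1 -> nat) -> F2).
Hypothesis c_lo : forall j, vanish (fun y => y j == 0%N) c.
Hypothesis c_hi : forall j, vanish (fun y => y j == N) c.

Let omit (x : 'I_n.+1 -> nat) r i :=
  c (take i (kuhn_simplex x r) ++ drop i.+1 (kuhn_simplex x r)).

Lemma omitE x r i : (i <= n.+1)%N ->
  omit x r i = c (map (kuhn_vertex x r) (iota 0 i ++ iota i.+1 (n.+1 - i))).
Proof.
move=> ile; rewrite /omit /kuhn_simplex /mkseq -map_take -map_drop map_cat.
by rewrite take_iota drop_iota (minn_idPl (leqW ile)) add0n.
Qed.

(* Exchanging steps [i - 1] and [i] changes only the [i]-th vertex and flips the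
   parity of [r], so the terms cancel in pairs. *)
Lemma sum_omit_mid x i : (0 < i < n.+1)%N -> \sum_r omit x r i = 0.
Proof.
case/andP=> i0 ilt.
have i1 : (i.-1 < n.+1)%N by lia.
pose a := Ordinal i1; pose b := Ordinal ilt; pose t := tperm a b.
have ab : a != b by rewrite -val_eqE /=; lia.
have omit_t r : omit x (r * t)%g i = omit x r i.
  rewrite !omitE ?(ltnW ilt) //; congr c; apply/eq_in_map => m.
  rewrite mem_cat !mem_iota => mi; apply/funext => j.
  rewrite /kuhn_vertex permM; congr (_ + nat_of_bool _)%N.
  by rewrite /t; case: tpermP => // -> /=; lia.
rewrite (bigID (fun r => odd_perm r)) /= (reindex_inj (mulIg t)) /=.
rewrite (eq_bigl (fun r => ~~ odd_perm r)) => [|r]; last first.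
  by rewrite odd_permM odd_tperm ab addbT.
under eq_bigr do rewrite omit_t.
exact: addrr_F2.
Qed.

(* The face without the first vertex is the face without the last vertex of a
   simplex in the next cube. *)
Lemma omit_first (x : 'I_n.+1 -> nat) (r : 'S_n.+1) :
  omit x (r * perm (@ordS_inj n.+1))%g 0 =
  omit (fun j => (x j + (r j == ord_max))%N) r n.+1.
Proof.
rewrite !omitE // subn0 subnn cats0 cat0s (iotaDl 1 0) -map_comp; congr c.
apply/eq_in_map => i; rewrite mem_iota /= add0n => ilt.
apply/funext => j; rewrite /kuhn_vertex /= permM permE /= add1n -addnA.
congr (_ + _)%N; rewrite -val_eqE /=.
have := ltn_ord (r j); case: eqP => [->|rj] rlt.
  by rewrite modnn; lia.
by rewrite modn_small; lia.
Qed.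

(** Middle faces cancel inside each cube, the first face of a simplex cancels the last face of one
    in an adjacent cube, and [c] vanishes on the unmatched faces, which lie on the boundary of the
    grid. *)
Lemma sum_cobd :
  \sum_(x : {ffun 'I_n.+1 -> 'I_N}) \sum_r cobd c (kuhn_simplex (fun i => x i) r)
  = 0.
Proof.
have cobd_omit x r : cobd c (kuhn_simplex x r) =
    omit x r 0 + omit x r n.+1 + \sum_(i < n) omit x r i.+1.
  rewrite cobdE size_mkseq (big_ord_recl n.+1) big_ord_recr.
  by rewrite -addrA [omit x r n.+1 + _]addrC.
under eq_bigr do under eq_bigr do rewrite cobd_omit.
under eq_bigr => x _.
  rewrite big_split /= [X in _ + X]exchange_big /= [X in _ + X]big1 => [|i _].
    by rewrite addr0 big_split /= (reindex_inj (mulIg (perm (@ordS_inj n.+1)))); over.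
  by apply: sum_omit_mid; have := ltn_ord i; lia.
rewrite big_split /=.
suff -> : \sum_(x : {ffun 'I_n.+1 -> 'I_N})
    \sum_r omit (fun i => x i) (r * perm (@ordS_inj n.+1))%g 0 =
  \sum_(x : {ffun 'I_n.+1 -> 'I_N}) \sum_r omit (fun i => x i) r n.+1.
  exact: addrr_F2.
rewrite exchange_big [RHS]exchange_big /=; apply: eq_bigr => r _.
under eq_bigr do rewrite omit_first.
(* All vertices but the last agree in the coordinate [j] incremented at the last step, so the face
   without the last vertex lies in a hyperplane y_j = const. *)
pose j := (r^-1)%g ord_max.
have facet m : (forall j, vanish (fun y : 'I_n.+1 -> nat => y j == m) c) ->
    forall y, y j = m -> omit y r n.+1 = 0.
  move=> vc y yj; rewrite omitE // subnn cats0; apply: (vc j).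
  rewrite all_map; apply/allP => i; rewrite mem_iota /= => ilt.
  by rewrite /kuhn_vertex permKV yj /=; lia.
rewrite -(@sum_shift_coord _ _ j (fun y => omit y r n.+1)); first last.
- exact: facet.
- exact: facet.
apply: eq_bigr => x _; congr (omit _ _ _); apply/funext => i.
by rewrite -(inj_eq (@perm_inj _ r) i) permKV.
Qed.
End Stokes.

(** * Invariance of the Kuhn sum and the discrete theorem *)

Definition kuhn_sum n N (F : 'I_n -> ('I_n -> nat) -> F2) : F2 :=
  \sum_(x : {ffun 'I_n -> 'I_N}) \sum_(r : 'S_n)
    cups F (enum 'I_n) (@cunit _) (kuhn_simplex (fun i => x i) r).

Definition miranda_label n N (F : 'I_n -> ('I_n -> nat) -> F2) : Prop :=
  forall k y, (y k = 0%N -> F k y = 0) /\ (y k = N -> F k y = 1).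

(** The difference of the sums is the sum of the coboundary of [c], which has the 0-cochain f_k +
    g_k in place of the factor df_k. It vanishes on the facets of coordinate k, where f_k = g_k, and
    on those of any other coordinate j, where f_j is constant. *)
Lemma kuhn_sum_replace n N (F G : 'I_n.+1 -> ('I_n.+1 -> nat) -> F2) k :
  miranda_label N F -> miranda_label N G ->
  (forall j, j != k -> F j = G j) -> kuhn_sum N F = kuhn_sum N G.
Proof.
move=> mF mG FG; apply/eqP; rewrite -subr_eq0; apply/eqP.
rewrite /kuhn_sum -sumrB; under eq_bigr do rewrite -sumrB.
have : uniq (enum 'I_n.+1) by exact: enum_uniq.
have := mem_enum 'I_n.+1; case/splitPr: (mem_enum 'I_n.+1 k) => pre post all_ks.
rewrite cat_uniq /= => /and3P[_ /norP[kpre _] /andP[kpost _]].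
pose h y := F k y + G k y.
pose c := cups F pre (cup0 h (cups F post (@cunit _))).
have cups_split (K : 'I_n.+1 -> ('I_n.+1 -> nat) -> F2) :
    (forall j, j != k -> F j = K j) ->
    cups K (pre ++ k :: post) (@cunit _) =
    cups F pre (cup1 (K k) (cups F post (@cunit _))).
  move=> FK; rewrite /cups foldr_cat /= -/(cups _ _ _) -/(cups _ _ _).
  have FK_in (ks : seq 'I_n.+1) : k \notin ks -> {in ks, K =1 F}.
    by move=> kks j jks; rewrite FK //; apply: contraNneq kks => <-.
  by rewrite (eq_in_cups _ (FK_in _ kpost)) (eq_in_cups _ (FK_in _ kpre)).
have c_vanish m (x : 'I_n.+1 -> F2) j :
    (forall i y, y i = m -> F i y = x i) -> (forall i y, y i = m -> G i y = x i) ->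
    vanish (fun y => y j == m) c.
  move=> Fm Gm; have [->|jk] := eqVneq j k.
    apply/vanish_cups/vanish_cup0_eq0 => y /eqP yk.
    by rewrite /h (Fm _ _ yk) (Gm _ _ yk) addrr_F2.
  have Fj y : y j == m -> F j y = x j by move/eqP/Fm.
  have: j \in pre ++ k :: post by rewrite all_ks.
  rewrite mem_cat inE (negPf jk) /= => /orP[jpre|jpost].
    exact: vanish_cups_const jpre Fj.
  apply/vanish_cups/vanish_cup0; exact: vanish_cups_const jpost Fj.
rewrite -[RHS](@sum_cobd n N c); first last.
- move=> j; apply: (c_vanish N (fun=> 1)) => i y yi.
    by case: (mF i y) => _; apply.
  by case: (mG i y) => _; apply.
- move=> j; apply: (c_vanish 0%N (fun=> 0)) => i y yi.
    by case: (mF i y) => + _; apply.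
  by case: (mG i y) => + _; apply.
apply: eq_bigr => x _; apply: eq_bigr => r _.
set s := kuhn_simplex _ _; rewrite !cups_split //.
rewrite oppr_F2 -cupsD.
(* The coboundary passes the factors in [pre] and turns [h] into dh; the other Leibniz term is 0 by
   [cobd_cunit]. *)
rewrite cobd_cups //; apply: eq_cups => t.
rewrite cobd_cup0 ?cups_nil // (_ : cup0 h _ t = 0) ?addr0.
  by case: t => [|a [|b t]] //=; rewrite ?addr0 // -mulrDl addrACA.
case: t => // a t; rewrite /cup0 cobd_cups // (eq_cups _ _ (@cobd_cunit _)).
by rewrite cups0 mulr0.
Qed.

(** Factor k is nonzero only if coordinate k goes from 0 to 1 at step k, which singles out the
    simplex at the origin with the identity permutation. *)
Lemma kuhn_sum_coord n N :
  kuhn_sum N.+1 (fun (k : 'I_n) y => (0 < y k)%N%:R) = 1.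
Proof.
rewrite /kuhn_sum.
under eq_bigr do under eq_bigr do rewrite cups_prod.
have termE (x : {ffun 'I_n -> 'I_N.+1}) (r : 'S_n) :
    \prod_(k : 'I_n) ((0 < kuhn_vertex (fun i => x i) r k k)%N%:R +
              (0 < kuhn_vertex (fun i => x i) r k.+1 k)%N%:R) =
    (if (x == [ffun=> ord0]) && (r == 1%g) then 1 else 0 : F2).
  case: ifPn => [/andP[/eqP-> /eqP->]|].
    by apply: big1 => k _; rewrite /kuhn_vertex perm1 ffunE ltnn ltnSn add0r.
  apply: contraNeq => /prodf_neq0 nz.
  have xr0 k : x k = 0%N :> nat /\ r k = k :> nat.
    have := nz k isT; rewrite /kuhn_vertex.
    have [->|xk] := posnP (x k); last by rewrite !ltn_addr // addrr_F2 eqxx.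
    by rewrite !add0n ltnS; case: (ltngtP (r k) k) => rk; rewrite ?addrr_F2 ?eqxx.
  apply/andP; split; apply/eqP; first apply/ffunP => k; last apply/permP => k.
    by apply/val_inj; rewrite ffunE /=; case: (xr0 k).
  by apply/val_inj; rewrite perm1; case: (xr0 k).
under eq_bigr do under eq_bigr do rewrite termE.
rewrite (bigD1 [ffun=> ord0]) //= (bigD1 1%g) //= !eqxx /= big1 => [|r /negPf ->//].
rewrite addr0 big1 ?addr0 // => x /negPf ->; exact: big1.
Qed.

(** The labels are exchanged one at a time: [M i] has the coordinate labels at indices below [i] and
    those of [F] from [i] on. *)
Lemma kuhn_sum_miranda n N (F : 'I_n.+1 -> ('I_n.+1 -> nat) -> F2) :
  (0 < N)%N -> miranda_label N F -> kuhn_sum N F = 1.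
Proof.
case: N => // N _ mF; rewrite -(kuhn_sum_coord n.+1 N).
pose G (k : 'I_n.+1) (y : 'I_n.+1 -> nat) : F2 := (0 < y k)%N%:R.
have mG : miranda_label N.+1 G by move=> k y; rewrite /G; split=> ->.
pose M (i : nat) (k : 'I_n.+1) := if (k < i)%N then G k else F k.
have mM i : miranda_label N.+1 (M i) by move=> k y; rewrite /M; case: ifP.
have -> : (fun (k : 'I_n.+1) y => (0 < y k)%N%:R) = M n.+1.
  by apply/funext => k; rewrite /M ltn_ord.
have -> : F = M 0%N by apply/funext => k; rewrite /M.
suff TM i : (i <= n.+1)%N -> kuhn_sum N.+1 (M 0%N) = kuhn_sum N.+1 (M i).
  exact: TM.
elim: i => // i IHi ilt; rewrite IHi ?(ltnW ilt) //.
apply: (@kuhn_sum_replace _ _ _ _ (Ordinal ilt)) => // j.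
rewrite -val_eqE /M /= => /negPf ji.
by rewrite ltnS [(j <= i)%N]leq_eqVlt ji.
Qed.

(** A sum equal to 1 has a nonzero term, and there every factor is nonzero: label [k] differs at the
    vertices [k] and [k.+1] of one Kuhn simplex. *)
Lemma discrete_miranda n N (f : 'I_n.+1 -> ('I_n.+1 -> nat) -> bool) :
  (0 < N)%N ->
  (forall k y, y k = 0%N -> f k y = false) ->
  (forall k y, y k = N -> f k y = true) ->
  exists2 x : 'I_n.+1 -> nat, (forall j, x j < N)%N &
    forall k b, exists2 y : 'I_n.+1 -> nat,
      (forall j, x j <= y j <= (x j).+1)%N & f k y = b.
Proof.
move=> N0 f0 fN; pose F k y : F2 := (f k y)%:R.
have mF : miranda_label N F.
  by move=> k y; rewrite /F; split=> [/f0|/fN] ->.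
have := kuhn_sum_miranda N0 mF; rewrite /kuhn_sum.
have [[x [r nz]]|no] := pselect (exists (x : {ffun 'I_n.+1 -> 'I_N}) r,
    cups F (enum 'I_n.+1) (@cunit _) (kuhn_simplex (fun i => x i) r) != 0);
  last first.
  rewrite big1 => [/eqP|x _]; first by rewrite eq_sym oner_eq0.
  apply: big1 => r _; apply/eqP/negPn/negP => nz; apply: no.
  by exists x, r.
move=> _; exists (fun j => x j) => // k b.
move: nz; rewrite cups_prod => /prodf_neq0/(_ k isT); rewrite /F.
set v := kuhn_vertex _ _.
have v_box i j : (x j <= v i j <= (x j).+1)%N.
  by rewrite /v /kuhn_vertex; case: (_ < _)%N; lia.
case: b; case fv: (f k (v k)); case fv': (f k (v k.+1));
  rewrite ?addrr_F2 ?addr0 ?eqxx // => _;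
  by [exists (v k)|exists (v k.+1)].
Qed.

End KuhnSums.

(** * The Poincare-Miranda theorem on a box *)

Section PoincareMiranda.
Variable R : realType.

Lemma mx_entry_norm m n (A : 'M[R]_(m, n)) i j : `|A i j| <= `|A|.
Proof.
rewrite [leRHS]/Num.norm /= mx_normrE.
exact: (le_bigmax _ (fun ij => `|A ij.1 ij.2|) (i, j)).
Qed.

Lemma mx_norm_le m n (A : 'M[R]_(m, n)) e :
  0 <= e -> (forall i j, `|A i j| <= e) -> `|A| <= e.
Proof.
by move=> e0 Ae; rewrite [leLHS]/Num.norm /= mx_normrE; apply: bigmax_le.
Qed.

Lemma box_compact n (l u : 'cV[R]_n) : compact (box l u).
Proof.
pose B := [set v : 'rV[R]_n | forall j, `[l j 0, u j 0]%classic (v ord0 j)].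
have -> : box l u = trmx @` B.
  apply/seteqP; split=> [x xlu|_ [v vB <-] j]; last first.
    by rewrite mxE; have := vB j; rewrite /= in_itv.
  by exists x^T; [move=> j /=; rewrite mxE in_itv; exact: xlu|rewrite trmxK].
apply: continuous_compact; last first.
  by apply: (@rV_compact _ _ (fun j => `[l j 0, u j 0]%classic)) => j; exact: segment_compact.
apply: continuous_subspaceT => v U /= /nbhs_ballP[e e0 eU].
apply/nbhs_ballP; exists e => //= w [_ vw]; apply: eU.
by split=> // i j; rewrite !mxE; exact: vw.
Qed.

(** On ever finer grids [discrete_miranda] gives points near which each component takes both signs;
    at a cluster point continuity forces the value 0. Edges of length 0 are allowed, which covers
    lambda^i = 0. *)
Lemma poincare_miranda n (l u : 'cV[R]_n.+1) (G : 'cV[R]_n.+1 -> 'cV[R]_n.+1) :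
  (forall j, l j 0 <= u j 0) ->
  {within box l u, continuous G} ->
  (forall x k, box l u x -> x k 0 = l k 0 -> G x k 0 <= 0) ->
  (forall x k, box l u x -> x k 0 = u k 0 -> 0 <= G x k 0) ->
  exists2 x, box l u x & G x = 0.
Proof.
move=> lu /subspace_continuousP Gc Gl Gu.
have grid N : exists2 x : 'cV[R]_n.+1, box l u x & forall k (b : bool),
    exists2 w, box l u w & `|w - x| <= `|u - l| / N.+1%:R /\
      (if b then 0 <= G w k 0 else G w k 0 <= 0).
  have N0 : 0 < N.+1%:R :> R by rewrite ltr0n.
  pose pt (y : 'I_n.+1 -> nat) : 'cV[R]_n.+1 :=
    \col_j (l j 0 + (y j)%:R / N.+1%:R * (u j 0 - l j 0)).
  have pt_box y : (forall j, y j <= N.+1)%N -> box l u (pt y).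
    move=> yN j; rewrite mxE.
    have t0 : 0 <= (y j)%:R / N.+1%:R :> R by rewrite divr_ge0.
    have t1 : (y j)%:R / N.+1%:R <= 1 :> R.
      by rewrite ler_pdivrMr // mul1r ler_nat; exact: yN.
    have := lu j; rewrite -subr_ge0 => d0.
    by rewrite lerDl mulr_ge0 //= -lerBrDl ler_piMl.
  (* Facet values are prescribed, since [G] may vanish on the upper facet and [y] also ranges over
     points outside the grid. On the grid, true gives G_k >= 0 and false gives G_k <= 0. *)
  pose f (k : 'I_n.+1) (y : 'I_n.+1 -> nat) :=
    (y k != 0%N) && ((y k == N.+1) || (0 < G (pt y) k 0)).
  have [||||x xN near_x] := @discrete_miranda 'F_2 _ n N.+1 f.
  - by move=> t; apply: addrr_pchar2; rewrite pchar_Fp.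
  - by [].
  - by move=> k y; rewrite /f => ->.
  - by move=> k y; rewrite /f => ->; rewrite eqxx.
  exists (pt x) => [|k b]; first by apply: pt_box => j; exact/ltnW/xN.
  have [y xy fy] := near_x k b.
  have yN j : (y j <= N.+1)%N by have := xy j; have := xN j; lia.
  exists (pt y); first exact: pt_box.
  split.
    apply: mx_norm_le => [|j i]; first by rewrite divr_ge0.
    have -> : (pt y - pt x) j i = ((y j)%:R - (x j)%:R) / N.+1%:R * (u - l) j 0.
      by rewrite !mxE; ring.
    rewrite normrM normrM [`|_^-1|]gtr0_norm ?invr_gt0 // mulrAC.
    rewrite ler_pM2r ?invr_gt0 // -[leRHS]mul1r ler_pM ?mx_entry_norm //.
    by rewrite -natrB ?normr_nat ?lern1; have := xy j; lia.
  move: fy; rewrite /f; case: b.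
    case/andP=> _ /orP[/eqP ykN|/ltW//].
    apply: (Gu _ _ (pt_box _ yN)); rewrite mxE ykN divff ?gt_eqF // mul1r.
    by rewrite addrC subrK.
  move/negbT; rewrite negb_and negb_or -leNgt negbK => /orP[/eqP yk0|/andP[//]].
  by apply: (Gl _ _ (pt_box _ yN)); rewrite mxE yk0 mul0r mul0r addr0.
pose xs N := sval (cid2 (grid N)).
have xsP N : box l u (xs N) by rewrite /xs; case: cid2.
have near_xs N k b : exists2 w, box l u w & `|w - xs N| <= `|u - l| / N.+1%:R /\
    (if b then 0 <= G w k 0 else G w k 0 <= 0).
  by rewrite /xs; case: cid2 => x xlu /= /(_ k b).
have [|x [xlu xcl]] := @box_compact _ l u (xs @ \oo) _.
  by exists 0%N => // N _; exact: xsP.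
exists x => //; apply/colP => k; rewrite [RHS]mxE.
apply/eqP/negPn/negP => Gx0.
have c0 : 0 < `|G x k 0| by rewrite normr_gt0.
have /cvgrPdist_lt/(_ _ c0) := Gc x xlu.
rewrite near_withinE => /nbhs_normP[r /= r0 Gr].
have [M MP] : exists M, forall N, (M <= N)%N -> `|u - l| / N.+1%:R < r / 2.
  exists (Num.bound (`|u - l| / (r / 2))) => N MN.
  rewrite ltr_pdivrMr // mulrC -ltr_pdivrMr ?divr_gt0 //.
  apply: lt_le_trans (archi_boundP _) _; first by rewrite !divr_ge0 // ltW.
  by rewrite ler_nat leqW.
have [||_ [[N MN <-]]] := xcl (xs @` [set N | (M <= N)%N]) (ball x (r / 2)).
- by exists M => // N MN; exists N.
- by apply: nbhsx_ballx; rewrite divr_gt0.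
rewrite mx_norm_ball /= => xN.
(* G_k(w) is 0 or of sign opposite to G_k(x), so the two differ by at least |G_k(x)|, against
   continuity at [x]. *)
have [w wlu [wxN wsgn]] := near_xs N k (G x k 0 < 0).
have : `|(G x - G w) k 0| < `|G x k 0|.
  apply: le_lt_trans (mx_entry_norm _ _ _) _; apply: Gr => //=.
  have -> : x - w = (x - xs N) - (w - xs N) by rewrite opprB addrA subrK.
  rewrite (le_lt_trans (ler_normB _ _)) // [ltRHS]splitr ltrD //.
  exact: le_lt_trans wxN (MP _ MN).
rewrite !mxE; move: wsgn; case: ltP => Gk.
  by move=> Gw; rewrite (ltr0_norm Gk) ltr0_norm; lra.
by move=> Gw; rewrite !ger0_norm; lra.
Qed.
End PoincareMiranda.

(** * Continuity and componentwise bounds *)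

Section Continuity.
Variable R : realType.

Lemma mulmx_norm_le m k n (A : 'M[R]_(m, k)) (B : 'M[R]_(k, n)) :
  `|A *m B| <= k%:R * `|A| * `|B|.
Proof.
apply: mx_norm_le => [|i j]; first by rewrite !mulr_ge0.
rewrite mxE (le_trans (ler_norm_sum _ _ _)) //.
have -> : k%:R * `|A| * `|B| = \sum_(l < k) `|A| * `|B|.
  by rewrite sumr_const card_ord -mulrA mulr_natl.
rewrite ler_sum // => l _.
by rewrite normrM ler_pM ?mx_entry_norm.
Qed.

Lemma has_jacobian_cvg k m (D : set 'cV[R]_k) (f : 'cV[R]_k -> 'cV[R]_m) y J :
  has_jacobian D f y J -> f y' @[y' --> within D (nbhs y)] --> f y.
Proof.
move=> fJ; apply/cvgrPdist_le => e e0.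
pose K := k%:R * `|J| + 1.
have K0 : 0 < K by rewrite ltr_wpDl // mulr_ge0.
have near_y : \forall y' \near y, `|y' - y| <= e / K.
  apply/nbhs_normP; exists (e / K) => /=.
    by rewrite divr_gt0.
  by move=> y' /= yy'; rewrite distrC ltW.
apply: filterS2 (cvg_within _ near_y) (fJ 1 ltr01) => y' yy' fy'; rewrite distrC.
have -> : f y' - f y = (f y' - f y - J *m (y' - y)) + J *m (y' - y).
  by rewrite subrK.
rewrite (le_trans (ler_normD _ _)) // (le_trans (lerD fy' (mulmx_norm_le _ _))) //.
by rewrite -mulrDl addrC mulrC -ler_pdivlMr.
Qed.

Lemma mulmx_continuous m k n (A : 'M[R]_(m, k)) :
  continuous (fun B : 'M[R]_(k, n) => A *m B).
Proof.
move=> B U /= /nbhs_ballP[e e0 eU].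
pose K := k%:R * `|A| + 1.
have K0 : 0 < K by rewrite ltr_wpDl // mulr_ge0.
apply/nbhs_ballP; exists (e / K) => /= [|B']; first exact: divr_gt0.
rewrite mx_norm_ball /= => BB'; apply: eU; rewrite mx_norm_ball /=.
rewrite -mulmxBr (le_lt_trans (mulmx_norm_le _ _)) //.
apply: le_lt_trans (_ : K * `|B - B'| < _); first by rewrite ler_wpM2r // lerDl.
by rewrite mulrC -ltr_pdivlMr.
Qed.

Lemma col_mx_continuous m1 m2 n (B : 'M[R]_(m2, n)) :
  continuous (fun A : 'M[R]_(m1, n) => col_mx A B).
Proof.
move=> A U /= /nbhs_ballP[e e0 eU]; apply/nbhs_ballP; exists e => // A' [_ AA'].
apply: eU; split=> // i j; rewrite -(fintype.splitK i).
case: (fintype.split i) => l /=; rewrite ?(col_mxEu, col_mxEd); first exact: AA'.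
exact: ballxx.
Qed.

End Continuity.

Section AbsoluteValues.
Variable R : realType.

Lemma mxabs_mul m k n (A : 'M[R]_(m, k)) (B : 'M[R]_(k, n)) :
  mxle (mxabs (A *m B)) (mxabs A *m mxabs B).
Proof.
move=> i j; rewrite !mxE (le_trans (ler_norm_sum _ _ _)) // ler_sum // => l _.
by rewrite !mxE normrM.
Qed.

Lemma mxle_refl m n (A : 'M[R]_(m, n)) : mxle A A.
Proof. by move=> i j. Qed.

Lemma mxabsN m n (A : 'M[R]_(m, n)) : mxabs (- A) = mxabs A.
Proof. by apply/matrixP => i j; rewrite !mxE normrN. Qed.

Lemma mxabsD m n (A B : 'M[R]_(m, n)) : mxle (mxabs (A + B)) (mxabs A + mxabs B).
Proof. by move=> i j; rewrite !mxE ler_normD. Qed.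

Lemma mxle_trans m n (A B E : 'M[R]_(m, n)) : mxle A B -> mxle B E -> mxle A E.
Proof. by move=> AB BE i j; rewrite (le_trans (AB i j)). Qed.

Lemma mxleD m n (A B A' B' : 'M[R]_(m, n)) :
  mxle A B -> mxle A' B' -> mxle (A + A') (B + B').
Proof. by move=> AB AB' i j; rewrite !mxE lerD. Qed.

Lemma mxleM m k n (A A' : 'M[R]_(m, k)) (B B' : 'M[R]_(k, n)) :
  mxle 0 A -> mxle 0 B -> mxle A A' -> mxle B B' -> mxle (A *m B) (A' *m B').
Proof.
move=> A0 B0 AA' BB' i j; rewrite !mxE ler_sum // => l _.
by rewrite ler_pM //; [have := A0 i l|have := B0 l j]; rewrite mxE.
Qed.

Lemma mxabs_ge0 m n (A : 'M[R]_(m, n)) : mxle 0 (mxabs A).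
Proof. by move=> i j; rewrite !mxE. Qed.

Lemma mxabs_le_ge0 m n (A B : 'M[R]_(m, n)) : mxle (mxabs A) B -> mxle 0 B.
Proof. exact/mxle_trans/mxabs_ge0. Qed.

Lemma tabs_ge0 m n k (T : tensor R m n k) i j l : 0 <= tabs T i j l.
Proof. exact: normr_ge0. Qed.

Lemma tmulv_abs m n k (T : tensor R m n k) u :
  mxle (mxabs (tmulv T u)) (tmulv (tabs T) (mxabs u)).
Proof.
move=> i j; rewrite !mxE (le_trans (ler_norm_sum _ _ _)) // ler_sum // => l _.
by rewrite !mxE normrM.
Qed.

Lemma tmulvM m n k (T T' : tensor R m n k) u u' :
  (forall i j l, 0 <= T i j l) -> mxle 0 u -> tle T T' -> mxle u u' ->
  mxle (tmulv T u) (tmulv T' u').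
Proof.
move=> T0 u0 TT' uu' i j; rewrite !mxE ler_sum // => l _.
by rewrite ler_pM //; have := u0 l 0; rewrite mxE.
Qed.

Lemma mulmx_tmulv m' m n k (M : 'M[R]_(m', m)) (T : tensor R m n k) u :
  M *m tmulv T u = tmulv (mmult M T) u.
Proof.
apply/matrixP => i j; rewrite !mxE.
under eq_bigr do rewrite mxE mulr_sumr.
rewrite exchange_big /=; apply: eq_bigr => l _.
by rewrite mulr_suml; apply: eq_bigr => h _; rewrite mulrA.
Qed.

Lemma tmulv_mulmx m n k k' (T : tensor R m n k) (N : 'M[R]_(k, k')) u :
  tmulv T (N *m u) = tmulv (tmulm T N) u.
Proof.
apply/matrixP => i j; rewrite !mxE.
under eq_bigr do rewrite mxE mulr_sumr.
rewrite exchange_big /=; apply: eq_bigr => l _.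
by rewrite mulr_suml; apply: eq_bigr => h _; rewrite mulrA.
Qed.

Lemma tmulm_abs m n k k' (T : tensor R m n k) (N : 'M[R]_(k, k')) :
  tle (tabs (tmulm T N)) (tmulm (tabs T) (mxabs N)).
Proof.
move=> i j l; rewrite /tabs /tmulm (le_trans (ler_norm_sum _ _ _)) //.
by rewrite ler_sum // => h _; rewrite !mxE normrM.
Qed.

Lemma tmulvZ m n k (T : tensor R m n k) t u : tmulv T (t *: u) = t *: tmulv T u.
Proof.
apply/matrixP => i j; rewrite !mxE mulr_sumr.
by apply: eq_bigr => l _; rewrite mxE mulrCA.
Qed.

End AbsoluteValues.

(** * The regions defined by a quadratic majorant *)

Section Regions.
Variable R : realType.

(** [t] is the largest ratio x_k / v_k; the contact index [k] later turns vector inequalities into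
    scalar ones. *)
Lemma max_ratio n (x v : 'cV[R]_n.+1) : mxpos v ->
  exists t k, mxle x (t *: v) /\ x k 0 = t * v k 0.
Proof.
move=> v0; case: (@Order.TotalTheory.arg_maxP _ _ _ ord0 xpredT
  (fun k => x k 0 / v k 0) isT) => k _ kmax.
exists (x k 0 / v k 0), k; split; last by rewrite divfK // gt_eqF.
by move=> i j; rewrite ord1 mxE -ler_pdivrMr //; exact: kmax.
Qed.

(** [e] is the larger root of a t^2 - w t + b, and [i] is the other one because the product of the
    roots is b / a. *)
Lemma quad_factor (a w b : R) : 0 < a -> 0 < w -> 0 < w ^+ 2 - 4 * a * b ->
  let e := (w + Num.sqrt (w ^+ 2 - 4 * a * b)) / (2 * a) in
  let i := b / (a * e) in
  0 < e /\ forall t, b - t * w + t ^+ 2 * a = a * (t - i) * (t - e).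
Proof.
move=> a0 w0 D0 /=; set D := _ - _ in D0 *; set e := _ / _.
have r0 : 0 < Num.sqrt D by rewrite sqrtr_gt0.
have r2 : Num.sqrt D ^+ 2 = D by rewrite sqr_sqrtr // ltW.
have e0 : 0 < e by rewrite divr_gt0 ?addr_gt0 ?mulr_gt0.
split=> // t.
have ew : e * (2 * a) = w + Num.sqrt D by rewrite divfK // gt_eqF ?mulr_gt0.
have eb : a * e ^+ 2 - w * e + b = 0.
  have : (e * (2 * a) - w) ^+ 2 = D by rewrite ew addrAC subrr add0r.
  rewrite /D => eD; apply: (mulfI (x := 4 * a)); first by rewrite gt_eqF ?mulr_gt0.
  by rewrite mulr0; lra.
have ae : a * e != 0 by rewrite mulf_neq0 ?gt_eqF.
set i := b / _.
have ib : i * (a * e) = b by rewrite divfK.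
have iw : a * (i + e) = w.
  apply: (mulIf (x := e)); first by rewrite gt_eqF.
  by move: eb; rewrite -ib => eb; lra.
by rewrite -iw -ib; ring.
Qed.

Lemma mulmx_le_scale n (A : 'M[R]_n) (u v : 'cV[R]_n) t :
  mxle 0 A -> mxle v (t *: u) -> mxle (A *m v) (t *: (A *m u)).
Proof.
move=> A0 vu i j; rewrite !mxE mulr_sumr ler_sum // => l _.
rewrite mulrCA ler_wpM2l //; first by have := A0 i l; rewrite mxE.
by have := vu l j; rewrite mxE.
Qed.

(* The Perron root of [A] is at most 1 by [A u <= u] and would exceed 1 by
   [A v > v]. *)
Lemma nonneg_mulmx_not_gt n (A : 'M[R]_n.+1) (u v : 'cV[R]_n.+1) :
  mxle 0 A -> mxpos u -> mxpos v -> mxle (A *m u) u ->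
  exists k, (A *m v) k 0 <= v k 0.
Proof.
move=> A0 u0 v0 Au; have [t [k [vu vk]]] := max_ratio v u0; exists k.
have t0 : 0 <= t by rewrite -(pmulr_lge0 _ (u0 k)) -vk ltW.
apply: le_trans (mulmx_le_scale A0 vu _ _) _.
by rewrite mxE vk ler_wpM2l.
Qed.

(** A kernel vector x satisfies |x| <= B0 |x|. At the contact index of |x| <= t v this gives t v_k
    <= t (B0 v)_k, so t <= 0 and x = 0. *)
Lemma near_identity_unitmx n (M B0 : 'M[R]_n.+1) (v : 'cV[R]_n.+1) :
  mxle (mxabs (M - 1%:M)) B0 -> mxpos v -> (forall j, (B0 *m v) j 0 < v j 0) ->
  M \in unitmx.
Proof.
move=> MB0 v0 Bv; rewrite unitmxE unitfE; apply/negP => /eqP detM.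
have : \det M^T == 0 by rewrite det_tr detM.
case/det0P => y y0 yM; case/negP: y0.
have B0_ge0 := mxabs_le_ge0 MB0.
pose x := y^T; have Mx : M *m x = 0 by rewrite /x -[M]trmxK -trmx_mul yM trmx0.
have xB : mxle (mxabs x) (B0 *m mxabs x).
  have {1}-> : x = - ((M - 1%:M) *m x) by rewrite mulmxBl Mx mul1mx sub0r opprK.
  rewrite mxabsN; apply: mxle_trans (mxabs_mul _ _) _; apply: mxleM => //; exact: mxabs_ge0.
have [t [k [xv xk]]] := max_ratio (mxabs x) v0.
have := xB k 0; rewrite xk => /le_trans/(_ (mulmx_le_scale B0_ge0 xv _ _)).
rewrite mxE; have [t0|t0 _] := ltP 0 t.
  by rewrite ler_pM2l // leNgt Bv.
apply/eqP/rowP => j; rewrite [RHS]mxE; apply/eqP; rewrite -normr_le0.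
have := xv j 0; rewrite !mxE => /le_trans; apply.
by rewrite mulr_le0_ge0 // ltW.
Qed.

Lemma vmin_le n (f : 'I_n.+1 -> R) j : vmin f <= f j.
Proof. exact: bigmin_le. Qed.

Lemma le_vmax n (f : 'I_n.+1 -> R) j : f j <= vmax f.
Proof. exact: le_bigmax. Qed.

Section Quadratics.
Variables (n : nat) (b v u : 'cV[R]_n.+1) (B0 : 'M[R]_n.+1).
Variable B : tensor R n.+1 n.+1 n.+1.
Hypotheses (b_ge0 : mxle 0 b) (B0_ge0 : mxle 0 B0).
Hypothesis B_ge0 : forall i j k, 0 <= B i j k.
Hypotheses (v_pos : mxpos v) (u_pos : mxpos u).
Hypothesis u_le : mxle (b + (B0 + tmulv B u) *m u) u.
Hypothesis D_pos : forall j, 0 < reg_D b B0 B v j.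
Hypothesis lam_lt : lami b B0 B v < lame b B0 B v.

Lemma tmulv_ge0 x : mxle 0 x -> mxle 0 (tmulv B x).
Proof.
move=> x0 i j; rewrite !mxE sumr_ge0 // => l _.
by rewrite mulr_ge0 //; have := x0 l 0; rewrite mxE.
Qed.

Lemma mulmx_ge0 m k p (A : 'M[R]_(m, k)) (E : 'M[R]_(k, p)) :
  mxle 0 A -> mxle 0 E -> mxle 0 (A *m E).
Proof.
move=> A0 E0 i j; rewrite !mxE sumr_ge0 // => l _.
by rewrite mulr_ge0 //; [have := A0 i l|have := E0 l j]; rewrite mxE.
Qed.

Lemma mxpos_ge0 m (x : 'cV[R]_m) : mxpos x -> mxle 0 x.
Proof. by move=> x0 i j; rewrite ord1 mxE ltW. Qed.

Let lam_lt_j j k : lami_j b B0 B v j < lame_j b B0 B v k.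
Proof.
by rewrite (le_lt_trans (le_vmax _ _)) // (lt_le_trans lam_lt) // vmin_le.
Qed.

Lemma reg_a_pos j : 0 < reg_a B v j 0.
Proof.
have v_ge0 := mxpos_ge0 v_pos.
have : mxle 0 (reg_a B v) by apply: mulmx_ge0 => //; exact: tmulv_ge0.
(* If a_j = 0, both lambdas are quotients by 0, hence 0, against lambda^i < lambda^e. *)
move/(_ j 0); rewrite mxE le_eqVlt => /orP[/eqP a0|//].
have := lam_lt_j j j; rewrite /lami_j /lame_j -a0 mulr0 invr0 mulr0 mul0r.
by rewrite invr0 mulr0 ltxx.
Qed.

Lemma reg_wE j : reg_w B0 v j 0 = v j 0 - (B0 *m v) j 0.
Proof. by rewrite /reg_w mulmxBl mul1mx !mxE. Qed.

(** By [nonneg_mulmx_not_gt] some w_k >= 0, so lambda^i_k >= 0. If w_j <= 0, then sqrt D_j <= |w_j|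
    makes lambda^e_j <= 0, against lambda^i_k < lambda^e_j. *)
Lemma reg_w_pos j : 0 < reg_w B0 v j 0.
Proof.
have Bu : mxle (B0 *m u) u.
  apply: mxle_trans u_le => i k; rewrite mulmxDl addrCA [leRHS]mxE lerDl.
  have u0 := mxpos_ge0 u_pos.
  have := mulmx_ge0 (tmulv_ge0 u0) u0; move/(_ i k).
  by have := b_ge0 i k; rewrite !mxE => *; rewrite addr_ge0.
have [k wk] := nonneg_mulmx_not_gt B0_ge0 u_pos v_pos Bu.
rewrite ltNge; apply/negP => wj.
have rootD i : 0 <= b i 0 -> Num.sqrt (reg_D b B0 B v i) <= `|reg_w B0 v i 0|.
  move=> bi; rewrite -sqrtr_sqr ler_wsqrtr // gerBl !mulr_ge0 // ltW //.
  exact: reg_a_pos.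
have bge0 i : 0 <= b i 0 by have := b_ge0 i 0; rewrite mxE.
have ej : lame_j b B0 B v j <= 0.
  have := rootD j (bge0 j); rewrite ler0_norm // => rD.
  rewrite mulr_le0_ge0 //; first by lra.
  by rewrite invr_ge0 mulr_ge0 // ltW // reg_a_pos.
have := lt_le_trans (lam_lt_j k j) ej; apply/negP; rewrite -leNgt.
rewrite divr_ge0 // mulr_ge0 ?(ltW (reg_a_pos k)) // divr_ge0 //.
  by rewrite addr_ge0 ?sqrtr_ge0 // reg_wE subr_ge0.
by rewrite mulr_ge0 // ltW ?reg_a_pos.
Qed.

Lemma reg_quadE j t :
  b j 0 - t * reg_w B0 v j 0 + t ^+ 2 * reg_a B v j 0 =
  reg_a B v j 0 * (t - lami_j b B0 B v j) * (t - lame_j b B0 B v j).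
Proof. by have [_ ->] := quad_factor (reg_a_pos j) (reg_w_pos j) (D_pos j). Qed.

Lemma lami_ge0 : 0 <= lami b B0 B v.
Proof.
apply: le_trans (le_vmax _ ord0); rewrite divr_ge0 //.
  by have := b_ge0 ord0 0; rewrite mxE.
have [e0 _] := quad_factor (reg_a_pos ord0) (reg_w_pos ord0) (D_pos ord0).
by rewrite mulr_ge0 // ltW // reg_a_pos.
Qed.

(** At |x - c| it bounds the residual |(x - c) - C H(x, s)|; the condition on [u] says that its
    value at [u] is at most [u]. *)
Definition majorant (x : 'cV[R]_n.+1) : 'cV[R]_n.+1 :=
  b + (B0 + tmulv B x) *m x.

(** The majorant is monotone on nonnegative vectors, and at t v its excess over t v_j is b_j - w_j t
    + a_j t^2, factored by [reg_quadE]. *)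
Lemma majorant_scale t j (x : 'cV[R]_n.+1) :
  0 <= t -> mxle 0 x -> mxle x (t *: v) ->
  majorant x j 0 <= t * v j 0 + reg_a B v j 0 *
    (t - lami_j b B0 B v j) * (t - lame_j b B0 B v j).
Proof.
move=> t0 x0 xv; rewrite -reg_quadE reg_wE.
have -> : t * v j 0 + (b j 0 - t * (v j 0 - (B0 *m v) j 0) +
    t ^+ 2 * reg_a B v j 0) =
    majorant (t *: v) j 0.
  have -> : majorant (t *: v) = b + t *: (B0 *m v) + t ^+ 2 *: reg_a B v.
    rewrite /majorant mulmxDl tmulvZ -!scalemxAr -scalemxAl scalerA -expr2.
    by rewrite addrA.
  by move: (B0 *m v) (reg_a B v) => y z; rewrite !mxE; ring.
rewrite [leLHS]mxE [leRHS]mxE lerD2l.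
have tv0 := mxle_trans x0 xv.
have B0x : mxle (B0 + tmulv B x) (B0 + tmulv B (t *: v)).
  by apply: mxleD => //; apply: tmulvM.
apply: (mxleM (A := B0 + tmulv B x)) => //.
apply: mxle_trans (B0_ge0) _ => i k.
by rewrite [leRHS]mxE lerDl; have := tmulv_ge0 x0 i k; rewrite mxE.
Qed.

End Quadratics.
End Regions.

(** * The preconditioned equation *)

#[local] Hint Resolve mxle_refl mxabs_ge0 tabs_ge0 : core.

Lemma newton_residual (R : realType) n (C J B0 : 'M[R]_n.+1)
    (T B : tensor R n.+1 n.+1 n.+1) (b c x y0 y : 'cV[R]_n.+1) :
  y = y0 + (J + tmulv T (x - c)) *m (x - c) ->
  mxle (mxabs (C *m y0)) b -> mxle (mxabs (C *m J - 1%:M)) B0 ->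
  tle (tabs (mmult C T)) B ->
  mxle (mxabs (x - c - C *m y)) (majorant b B0 B (mxabs (x - c))).
Proof.
move=> -> Cb CB0 CB; move: (x - c) => d.
have -> : d - C *m (y0 + (J + tmulv T d) *m d) =
    - (C *m y0 + ((C *m J - 1%:M) + tmulv (mmult C T) d) *m d).
  rewrite mulmxDr mulmxA mulmxDr mulmx_tmulv 3!mulmxDl mulNmx mul1mx.
  move: (C *m y0) (C *m J *m d) (tmulv _ _ *m d) => y1 y2 y3.
  by apply/colP => i; rewrite !mxE; ring.
rewrite mxabsN; apply: mxle_trans (mxabsD _ _) _.
apply: mxleD => //; apply: mxle_trans (mxabs_mul _ _) _.
apply: mxleM => //.
apply: mxle_trans (mxabsD _ _) _; apply: mxleD => //.
apply: mxle_trans (tmulv_abs _ _) _; exact: tmulvM.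
Qed.

(** From an interior point, x - c can be stretched by some factor 1 + t > 1 without leaving the
    box. *)
Lemma interior_box_lt (R : realType) n (c r x : 'cV[R]_n) (D : set 'cV[R]_n) :
  mxpos r -> (box (c - r) (c + r) `&` D)^° x ->
  forall j, `|x j 0 - c j 0| < r j 0.
Proof.
move=> r0 /nbhs_ballP[e /= e0 xe] j.
have [->|xcj] := eqVneq (x j 0) (c j 0); first by rewrite subrr normr0.
pose d := x - c.
have d0 : 0 < `|d|.
  have := mx_entry_norm d j 0; apply: lt_le_trans.
  by rewrite !mxE normr_gt0 subr_eq0.
(* The displacement t d has norm e / 2 < e. *)
pose t := e / (2 * `|d|).
have t0 : 0 < t by rewrite divr_gt0 ?mulr_gt0.
have [/(_ j)] : (box (c - r) (c + r) `&` D) (x + t *: d).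
  apply: xe; rewrite mx_norm_ball /= opprD addrA subrr add0r normrN normrZ.
  rewrite gtr0_norm // /t invfM mulrA mulfVK ?gt_eqF // ltr_pdivrMr //.
  by rewrite ltr_pMr // ltr1n.
rewrite !mxE => /andP[lo hi] _.
have : (1 + t) * `|x j 0 - c j 0| <= r j 0.
  by rewrite -[1 + t]gtr0_norm ?addr_gt0 // -normrM ler_norml; lra.
apply: lt_le_trans; rewrite ltr_pMl ?ltrDl //.
by rewrite normr_gt0 subr_eq0.
Qed.

Lemma graph_slopeE (R : realType) (n q : nat) (xhat : 'cV[R]_q -> 'cV[R]_n)
    (xsl : 'cV[R]_q -> 'cV[R]_q -> 'M[R]_(n, q)) (p s : 'cV[R]_q) :
  is_slope xhat p s (xsl p s) ->
  graph_pt xhat s - graph_pt xhat p = graph_slope xsl p s *m (s - p).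
Proof.
by move=> xs; rewrite opp_col_mx add_col_mx mul_col_mx mul1mx xs.
Qed.

(** Slopes compose: H(g(s)) - H(g(p)) = H[g(p), g(s)] g[p, s] (s - p). *)
Lemma par_b_bound (R : realType) (n q : nat) (C : 'M[R]_n)
    (H : 'cV[R]_(n + q) -> 'cV[R]_n)
    (Hsl : 'cV[R]_(n + q) -> 'cV[R]_(n + q) -> 'M[R]_(n, n + q))
    (xhat : 'cV[R]_q -> 'cV[R]_n) (xsl : 'cV[R]_q -> 'cV[R]_q -> 'M[R]_(n, q))
    (b : 'cV[R]_n) (p s : 'cV[R]_q) :
  is_slope xhat p s (xsl p s) ->
  is_slope H (graph_pt xhat p) (graph_pt xhat s)
    (Hsl (graph_pt xhat p) (graph_pt xhat s)) ->
  mxle (mxabs (C *m H (graph_pt xhat p))) b ->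
  mxle (mxabs (C *m H (graph_pt xhat s))) (par_b C Hsl xhat xsl b p s).
Proof.
move=> xs Hs Hb.
have -> : H (graph_pt xhat s) = H (graph_pt xhat p) +
    Hsl (graph_pt xhat p) (graph_pt xhat s) *m (graph_slope xsl p s *m (s - p)).
  by rewrite -(graph_slopeE xs) -Hs addrC subrK.
rewrite mulmxDr !mulmxA; apply: mxle_trans (mxabsD _ _) _; apply: mxleD => //.
apply: mxle_trans (mxabs_mul _ _) _.
apply: mxleM => //.
exact: mxabs_mul.
Qed.

Lemma par_B0_bound (R : realType) (n q : nat) (C : 'M[R]_n)
    (F : 'cV[R]_(n + q) -> 'M[R]_n)
    (dHxsl : 'cV[R]_(n + q) -> 'cV[R]_(n + q) -> tensor R n n (n + q))
    (xhat : 'cV[R]_q -> 'cV[R]_n) (xsl : 'cV[R]_q -> 'cV[R]_q -> 'M[R]_(n, q))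
    (B0 : 'M[R]_n) (p s : 'cV[R]_q) :
  is_slope xhat p s (xsl p s) ->
  is_tslope F (graph_pt xhat p) (graph_pt xhat s)
    (dHxsl (graph_pt xhat p) (graph_pt xhat s)) ->
  mxle (mxabs (C *m F (graph_pt xhat p) - 1%:M)) B0 ->
  mxle (mxabs (C *m F (graph_pt xhat s) - 1%:M))
    (par_B0 C dHxsl xhat xsl B0 p s).
Proof.
move=> xs Fs FB0.
have -> : F (graph_pt xhat s) = F (graph_pt xhat p) +
    tmulv (dHxsl (graph_pt xhat p) (graph_pt xhat s))
      (graph_slope xsl p s *m (s - p)).
  by rewrite -(graph_slopeE xs) -Fs addrC subrK.
rewrite mulmxDr mulmx_tmulv tmulv_mulmx addrAC.
apply: mxle_trans (mxabsD _ _) _; apply: mxleD => //.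
apply: mxle_trans (tmulv_abs _ _) _; apply: tmulvM => //.
exact: tmulm_abs.
Qed.

Theorem theorem4p3 (R : realType) (n q : nat)
  (X : set 'cV[R]_n.+1) (S : set 'cV[R]_q)
  (* H, its derivative dH on X x S, and its Jacobian dHx with respect to x *)
  (H : 'cV[R]_(n.+1 + q) -> 'cV[R]_n.+1)
  (dH : 'cV[R]_(n.+1 + q) -> 'M[R]_(n.+1, n.+1 + q))
  (dH_der : forall y, pairs X S y -> has_jacobian (pairs X S) H y (dH y))
  (dH_lip : [lipschitz dH y | y in pairs X S])
  (dHx : 'cV[R]_(n.+1 + q) -> 'M[R]_n.+1)
  (dHx_def : forall y, dHx y = lsubmx (dH y))
  (* the boxes [xl, xu] and [sl, su], the center (z, p), the preconditioner *)
  (xl xu : 'cV[R]_n.+1) (sl su : 'cV[R]_q)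
  (xX : box xl xu `<=` X) (sS : box sl su `<=` S)
  (z : 'cV[R]_n.+1) (p : 'cV[R]_q)
  (zx : box xl xu z) (ps : box sl su p)
  (dHx_reg : dHx (col_mx z p) \in unitmx)
  (C : 'M[R]_n.+1)
  (* slopes *)
  (Hsl : 'cV[R]_(n.+1 + q) -> 'cV[R]_(n.+1 + q) -> 'M[R]_(n.+1, n.+1 + q))
  (Hsl_slope : forall y1 y2, pairs X S y1 -> pairs X S y2 ->
     is_slope H y1 y2 (Hsl y1 y2))
  (dHxsl : 'cV[R]_(n.+1 + q) -> 'cV[R]_(n.+1 + q) ->
     tensor R n.+1 n.+1 (n.+1 + q))
  (dHxsl_slope : forall y1 y2, pairs X S y1 -> pairs X S y2 ->
     is_tslope dHx y1 y2 (dHxsl y1 y2))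
  (Hxx : 'cV[R]_(n.+1 + q) -> 'cV[R]_(n.+1 + q) -> 'cV[R]_(n.+1 + q) ->
     tensor R n.+1 n.+1 n.+1)
  (Hxx_slope : forall x1 x2 t, X x1 -> X x2 -> S t ->
     lsubmx (Hsl (col_mx x1 t) (col_mx x2 t)) =
     dHx (col_mx x1 t) +
     tmulv (Hxx (col_mx x1 t) (col_mx x1 t) (col_mx x2 t)) (x2 - x1))
  (* base bounds, and regions at (z, p) *)
  (b : 'cV[R]_n.+1) (B0 : 'M[R]_n.+1) (B : tensor R n.+1 n.+1 n.+1)
  (b_bound : mxle (mxabs (C *m H (col_mx z p))) b)
  (B0_bound : mxle (mxabs (C *m dHx (col_mx z p) - 1%:M)) B0)
  (B_bound : forall x, box xl xu x ->
     tle (tabs (mmult C (Hxx (col_mx z p) (col_mx z p) (col_mx x p)))) B)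
  (v0 : 'cV[R]_n.+1) (v0_pos : mxpos v0)
  (D0_pos : forall j, 0 < reg_D b B0 B v0 j)
  (lam0 : lami b B0 B v0 < lame b B0 B v0)
  (Ri0 : box (z - lami b B0 B v0 *: v0) (z + lami b B0 B v0 *: v0)
           `<=` box xl xu)
  (* approximation function *)
  (xhat : 'cV[R]_q -> 'cV[R]_n.+1)
  (xhat_C1 : continuously_differentiable xhat)
  (xhat_p : xhat p = z)
  (xhat_x : forall t, box sl su t -> box xl xu (xhat t))
  (xsl : 'cV[R]_q -> 'cV[R]_q -> 'M[R]_(n.+1, q))
  (xsl_slope : forall t, box sl su t -> is_slope xhat p t (xsl p t))
  (* the bounds B(x, s) *)
  (Bxs : 'cV[R]_n.+1 -> 'cV[R]_q -> tensor R n.+1 n.+1 n.+1)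
  (Bxs_bound : forall x t, box xl xu x -> box sl su t ->
     tle (tabs (mmult C (Hxx (graph_pt xhat t) (graph_pt xhat t) (col_mx x t))))
       (Bxs x t))
  (* the parameter value s, the vectors u and v *)
  (s : 'cV[R]_q) (ss : box sl su s) (xhat_int : (box xl xu)^° (xhat s))
  (u : 'cV[R]_n.+1) (u_pos : mxpos u) (Bs : tensor R n.+1 n.+1 n.+1) :
  let bs := par_b C Hsl xhat xsl b p s in
  let B0s := par_B0 C dHxsl xhat xsl B0 p s in
  let Mu := [set x : 'cV[R]_n.+1 | mxle (mxabs (x - xhat s)) u] in
  mxle (bs + (B0s + tmulv Bs u) *m u) u ->
  Mu `<=` box xl xu ->
  (forall x, Mu x -> tle (Bxs x s) Bs) ->
  (forall x, box xl xu x -> tle (Bxs x s) Bs) ->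
  forall v : 'cV[R]_n.+1, mxpos v ->
  (forall j, 0 < reg_D bs B0s Bs v j) ->
  let lamE := lame bs B0s Bs v in
  let lamI := lami bs B0s Bs v in
  lamI < lamE ->
  (forall j (r : R), -1 <= r <= 1 ->
     xl j 0 <= xhat s j 0 + r * (lamI * v j 0) <= xu j 0) ->
  let Ri := box (xhat s - lamI *: v) (xhat s + lamI *: v) in
  let Re := box (xhat s - lamE *: v) (xhat s + lamE *: v) `&` box xl xu in
  [/\ Ri `<=` box xl xu,
      exists2 x, Ri x & H (col_mx x s) = 0
    & forall x, Re^° x -> H (col_mx x s) = 0 -> Ri x].
Proof.
move=> bs B0s Mu u_le Mu_x _ Bs_bound v v_pos D_pos lamE lamI lam_lt Ri_x Ri Re.
pose c := xhat s; pose h x := H (col_mx x s).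
have c_x : box xl xu c := xhat_x _ ss.
have graph_XS x t : box xl xu x -> box sl su t -> pairs X S (col_mx x t).
  by move=> xx tt; rewrite /pairs /= col_mxKu col_mxKd; split; [exact: xX|exact: sS].
have xs := xsl_slope _ ss.
have gp : pairs X S (graph_pt xhat p) by apply: graph_XS => //; exact: xhat_x.
have gs : pairs X S (graph_pt xhat s) by apply: graph_XS.
have gpE : graph_pt xhat p = col_mx z p by rewrite /graph_pt xhat_p.
have bs_bound : mxle (mxabs (C *m h c)) bs.
  by apply: par_b_bound => //; [exact: Hsl_slope|rewrite gpE].
have B0s_bound : mxle (mxabs (C *m dHx (col_mx c s) - 1%:M)) B0s.
  by apply: par_B0_bound => //; [exact: dHxsl_slope|rewrite gpE].
have T_bound x : box xl xu x ->
    tle (tabs (mmult C (Hxx (col_mx c s) (col_mx c s) (col_mx x s)))) Bs.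
  move=> xx i j k; exact: le_trans (Bxs_bound _ _ xx ss i j k) (Bs_bound _ xx i j k).
have Bs_ge0 i j k : 0 <= Bs i j k.
  exact: le_trans (normr_ge0 _) (T_bound _ c_x i j k).
have bs_ge0 := mxabs_le_ge0 bs_bound; have B0s_ge0 := mxabs_le_ge0 B0s_bound.
have residual x : box xl xu x ->
    mxle (mxabs (x - c - C *m h x)) (majorant bs B0s Bs (mxabs (x - c))).
  move=> xx; apply: newton_residual (bs_bound) B0s_bound (T_bound _ xx).
  (* Both points carry the parameter [s]: the bracket is the x-part of the slope of [H], and the
     remaining columns act on 0. *)
  rewrite -Hxx_slope //; [|exact: xX|exact: xX|exact: sS].
  have := Hsl_slope _ _ gs (graph_XS _ _ xx ss).
  rewrite /is_slope /graph_pt -[Hsl _ _ in RHS]hsubmxK opp_col_mx add_col_mx subrr.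
  by rewrite mul_row_col mulmx0 addr0 => <-; rewrite addrC subrK.
have w_pos := reg_w_pos bs_ge0 B0s_ge0 Bs_ge0 v_pos u_pos u_le lam_lt.
have a_pos := reg_a_pos Bs_ge0 v_pos lam_lt.
have lamI_ge0 : 0 <= lamI :=
  lami_ge0 bs_ge0 B0s_ge0 Bs_ge0 v_pos u_pos u_le D_pos lam_lt.
have maj := majorant_scale bs_ge0 B0s_ge0 Bs_ge0 v_pos u_pos u_le D_pos lam_lt.
have C_unit : C \in unitmx.
  have : C *m dHx (col_mx c s) \in unitmx.
    apply: near_identity_unitmx B0s_bound v_pos _ => j.
    by rewrite -subr_gt0 -reg_wE.
  by rewrite unitmx_mul => /andP[].
have RiP x : Ri x <-> mxle (mxabs (x - c)) (lamI *: v).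
  split=> [xR i j|xR j].
    by have := xR i; rewrite ord1 !mxE ler_norml; lra.
  by have := xR j 0; rewrite !mxE ler_norml; lra.
have Ri_sub : Ri `<=` box xl xu.
  move=> x xR j; have := xR j; rewrite !mxE.
  by have := Ri_x j (-1); have := Ri_x j 1; lra.
split=> //.
  have Cc : {within Ri, continuous (fun x => C *m h x)}.
    apply/subspace_continuousP => x xR.
    (* Continuity of [H] relative to X x S is pulled back along x |-> (x, s), which maps R^i into X
       x S. *)
    have Hc := has_jacobian_cvg (dH_der _ (graph_XS _ _ (Ri_sub _ xR) ss)).
    apply: (@cvg_comp _ _ _ h (mulmx C)); last exact: mulmx_continuous.
    apply: cvg_comp Hc => U /= /col_mx_continuous XSU.
    apply: (@filterS _ (nbhs x) _ _ _ _ XSU) => x' {}XSU x'R.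
    by apply: XSU; exact/graph_XS/ss/Ri_sub.
  have sgn x k : Ri x -> `|(x - c - C *m h x) k 0| <= lamI * v k 0.
    move=> xR; have := residual _ (Ri_sub _ xR) k 0; rewrite mxE => /le_trans; apply.
    apply: le_trans (maj _ k _ lamI_ge0 (mxabs_ge0 _) (proj1 (RiP x) xR)) _.
    rewrite gerDl mulr_ge0_le0 ?mulr_ge0 ?subr_ge0 ?subr_le0 //.
    - exact: ltW.
    - exact: le_vmax.
    - by rewrite (le_trans (ltW lam_lt)) // vmin_le.
  have [|||x xR Cx0] := poincare_miranda _ Cc.
  - move=> j; rewrite !mxE.
    by have := v_pos j; nra.
  (* With L = lambda^i v_k and g the k-th component of C H(x, s), x_k - c_k = -L and |-L - g| <= L
     give g <= 0. *)
  - move=> x k xR xk; have := sgn x k xR; rewrite !mxE in xk *.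
    by rewrite ler_norml; lra.
  - move=> x k xR xk; have := sgn x k xR; rewrite !mxE in xk *.
    by rewrite ler_norml; lra.
  exists x => //.
  by rewrite -[LHS](mulKmx C_unit) Cx0 mulmx0.
move=> x xRe hx0; apply/RiP.
have xx : box xl xu x by have [] := interior_subset xRe.
have lamE_gt0 : 0 < lamE := le_lt_trans lamI_ge0 lam_lt.
have x_lt : forall j, `|x j 0 - c j 0| < (lamE *: v) j 0.
  by apply: interior_box_lt xRe => j; rewrite mxE mulr_gt0.
have [t [k [xt xk]]] := max_ratio (mxabs (x - c)) v_pos.
have t0 : 0 <= t by rewrite -(pmulr_lge0 _ (v_pos k)) -xk mxE.
have tE : t < lamE.
  by rewrite -(ltr_pM2r (v_pos k)) -xk; have := x_lt k; rewrite !mxE.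
have [tI|tI] := leP t lamI.
  apply: mxle_trans xt _ => i j; rewrite !mxE ler_wpM2r // ord1; exact: ltW.
have := residual _ xx k 0; rewrite [h x]hx0 mulmx0 subr0 xk.
move/le_trans/(_ (maj _ k _ t0 (mxabs_ge0 _) xt)).
rewrite lerDl leNgt => /negP[].
rewrite pmulr_rlt0 ?mulr_gt0 ?subr_gt0 ?subr_lt0 //.
  by rewrite (lt_le_trans tE) // vmin_le.
by rewrite (le_lt_trans _ tI) // le_vmax.
Qed.
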